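(* Let $1\le p<\infty$ and $k>0$. The set of isomorphism classes of compact pmm-spaces, endowed with the metric $\mathsf{PGW}^k_p$, is not complete.
   Context: A pmm-space is a triple $(X,d_X,\mu_X)$ with $(X,d_X)$ a complete separable metric space and $\mu_X$ a Borel probability measure; compact means $(X,d_X)$ compact. Isomorphic means there is a measure-preserving isometric bijection. For a measure $\pi$ on $X\times Y$, $\pi_X,\pi_Y$ are its marginals and $\|d_X-d_Y\|_{L^p(\pi\otimes\pi)}=\left(\iint|d_X(x,x')-d_Y(y,y')|^p\,d\pi(x,y)\,d\pi(x',y')\right)^{1/p}$. For scalar $\epsilon\ge0$: $\mathsf{PGW}_{\epsilon,p}(X,Y)=\inf\{\|d_X-d_Y\|_{L^p(\pi\otimes\pi)}:\pi$ Borel probability measure on $X\times Y$, $\pi_X\le(1+\epsilon)\mu_X$, $\pi_Y\le(1+\epsilon)\mu_Y$ setwise$\}$, and $\mathsf{PGW}^k_p(X,Y)=\inf\{\frac{\epsilon}{1+\epsilon}:\epsilon\ge0,\ \mathsf{PGW}_{\epsilon,p}(X,Y)\le k\epsilon\}$. *)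

(* Defs.v *)
From HB Require Import structures.
From mathcomp Require Import all_boot all_order all_algebra.
From mathcomp Require Import all_classical all_reals all_analysis.
Set Implicit Arguments. Unset Strict Implicit. Unset Printing Implicit Defensive.
Import Order.TTheory GRing.Theory Num.Theory.
Local Open Scope classical_set_scope.
Local Open Scope ring_scope.

Section metric_notions.
Context {R : realType} {T : Type}.
Implicit Types (d : T -> T -> R).

Definition is_metric d :=
  [/\ forall x y, 0 <= d x y,
      forall x y, d x y = 0 <-> x = y,
      forall x y, d x y = d y x &
      forall x y z, d x z <= d x y + d y z].

Definition metric_open d : set (set T) :=
  [set A | forall x, A x -> exists r : R, 0 < r /\ [set y | d x y < r] `<=` A].

Definition metric_cauchy d (u : nat -> T) :=
  forall e : R, 0 < e -> exists N : nat, forall m n : nat,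
    (N <= m)%N -> (N <= n)%N -> d (u m) (u n) < e.

Definition metric_complete d :=
  forall u : nat -> T, metric_cauchy d u ->
    exists x : T, forall e : R, 0 < e -> exists N : nat, forall n : nat,
      (N <= n)%N -> d (u n) x < e.

Definition metric_separable d :=
  exists S : set T, countable S /\
    forall (x : T) (r : R), 0 < r -> exists2 y, S y & d x y < r.

Definition metric_compact d :=
  forall C : set (set T), C `<=` metric_open d -> \bigcup_(A in C) A = setT ->
    exists D : set (set T), [/\ finite_set D, D `<=` C & \bigcup_(A in D) A = setT].

End metric_notions.

Record pmm (R : realType) := PMM {
  pmm_T : pointedType;
  pmm_d : pmm_T -> pmm_T -> R;
  pmm_is_metric : is_metric pmm_d;
  pmm_complete : metric_complete pmm_d;
  pmm_separable : metric_separable pmm_d;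
  pmm_mu : probability (g_sigma_algebraType (metric_open pmm_d)) R }.

Definition pmm_space (R : realType) (X : pmm R) :=
  g_sigma_algebraType (metric_open (@pmm_d R X)).

Definition pmm_compact (R : realType) (X : pmm R) := metric_compact (@pmm_d R X).

Section PGW.
Context {R : realType}.
Local Open Scope ereal_scope.

Definition dis_Lp (X Y : pmm R) (p : R)
    (pi : set (pmm_space X * pmm_space Y)%type -> \bar R) : \bar R :=
  (\int[pi \x pi]_z
     ((`| pmm_d z.1.1 z.2.1 - pmm_d z.1.2 z.2.2 | `^ p)%R)%:E) `^ p^-1.

Definition pcoupling (X Y : pmm R) (eps : R)
    (pi : probability (pmm_space X * pmm_space Y)%type R) :=
  (forall A : set (pmm_space X), measurable A ->
     pi (A `*` setT) <= (1 + eps)%:E * pmm_mu X A) /\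
  (forall B : set (pmm_space Y), measurable B ->
     pi (setT `*` B) <= (1 + eps)%:E * pmm_mu Y B).

Definition PGW_eps (eps p : R) (X Y : pmm R) : \bar R :=
  ereal_inf [set c | exists pi : probability (pmm_space X * pmm_space Y)%type R,
                        pcoupling eps pi /\ c = dis_Lp p pi].

Definition PGWk (k p : R) (X Y : pmm R) : \bar R :=
  ereal_inf [set ((eps / (1 + eps))%R)%:E | eps in
               [set eps : R | (0 <= eps)%R /\ PGW_eps eps p X Y <= (k * eps)%:E]].

End PGW.

(* Main.v *)
(* Let X_n be the discrete metric space {0, ..., n} carrying the image of a
   fixed law P on nat with full support (here Poisson) under i |-> min(i, n).
   For K <= m, n, the natural coupling of X_m and X_n conditioned on {i < K}
   has zero distortion, and its marginals are dominated up to the factor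
   1 / P{i < K}; hence PGW^k_p(X_m, X_n) <= 1 - P{i < K}, and the sequence is
   Cauchy.

   A compact Y is covered by N open sets B_j of diameter at most 1/2.  In a
   partial coupling of X_n and Y with small eps, each of the N + 1 atoms
   0, ..., N of X_n keeps a mass bounded below, so sends a definite mass s into
   some B_j; by pigeonhole two atoms, at distance 1, share the same B_j, and the
   p-th power of the distortion is at least s^2 / 2^p. *)
Require Import Defs.
From HB Require Import structures.
From mathcomp Require Import all_boot all_order all_algebra.
From mathcomp Require Import all_classical all_reals all_analysis.
From mathcomp Require Import measurable_realfun ring lra.
Import Order.TTheory GRing.Theory Num.Theory.
Local Open Scope classical_set_scope.
Local Open Scope ring_scope.
Set Implicit Arguments.
Unset Strict Implicit.
Unset Printing Implicit Defensive.

(** * Integrals over a measurable space and over its square *)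

Section integral_bounds.
Context d (T : measurableType d) (R : realType).
Local Open Scope ereal_scope.
Import HBNNSimple.

(* No measurability of [f] is needed: the integral of a nonnegative function is
   a supremum over the simple functions below it. *)
Lemma integral_ge_cst_on (mu : {measure set T -> \bar R}) (A : set T) (c : R)
    (f : T -> \bar R) :
  measurable A -> (0 <= c)%R -> (forall x, 0 <= f x) ->
  (forall x, A x -> c%:E <= f x) -> c%:E * mu A <= \int[mu]_x f x.
Proof.
move=> mA c0 f0 cf; rewrite ge0_integralTE//.
apply: ereal_sup_ubound; exists (scale_nnsfun (indic_nnsfun R mA) c0) => /=.
  move=> x; rewrite -[X in X%:E <= _]/(c * \1_A x)%R indicE.
  case: (boolP (x \in A)) => [/set_mem/cf|_]; first by rewrite mulr1.
  by rewrite mulr0.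
by rewrite sintegralrM -(sintegral_indic mu).
Qed.

(** Outside the square of [D] lie two strips, each with one coordinate in the complement of [D].
    Both are null because [D] has full mass, so [f] vanishes almost everywhere. *)
Lemma integral_prod_eq0 (P : probability T R) (D : set T)
    (f : T * T -> \bar R) :
  measurable D -> P D = 1 -> measurable_fun [set: T * T] f ->
  (forall x y, D x -> D y -> f (x, y) = 0) ->
  \int[P \x P]_z f z = 0.
Proof.
move=> mD PD mf f0.
have mDC := measurableC mD.
have PDC : P (~` D) = 0 by rewrite probability_setC// PD subee.
rewrite (@ae_eq_integral _ _ _ _ _ (cst 0) f) ?integral_cst ?mul0e//.
exists ((~` D `*` setT) `|` (setT `*` ~` D)); split.
- by apply: measurableU; exact: measurableX.
- have E1 : (P \x P) (~` D `*` setT) = 0.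
    by rewrite -[0](mul0e (P setT)) -PDC; exact: product_measure1E.
  have E2 : (P \x P) (setT `*` ~` D) = 0.
    by rewrite -[0](mule0 (P setT)) -PDC; exact: product_measure1E.
  have : (P \x P) ((~` D `*` setT) `|` (setT `*` ~` D))
      <= (P \x P) (~` D `*` setT) + (P \x P) (setT `*` ~` D).
    by apply: measureU2; exact: measurableX.
  rewrite E1 E2 adde0 => le0.
  by apply/eqP; rewrite eq_le le0 /=; exact: measure_ge0.
- move=> [x y] /=; apply: contra_notP => /not_orP[/= nx ny] _; apply: f0.
    by apply: contrapT => Dx; apply: nx.
  by apply: contrapT => Dy; apply: ny.
Qed.

End integral_bounds.

(** * Discrete metrics and finite metric spaces *)

Section discrete_metric.
Context (R : realType).

Definition discrete_dist (T : eqType) (x y : T) : R := (x != y)%:R.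

Lemma discrete_dist_lt1 (T : eqType) (x y : T) :
  discrete_dist x y < 1 -> x = y.
Proof. by rewrite /discrete_dist; case: eqP => // _; rewrite ltxx. Qed.

Lemma discrete_dist_is_metric (T : eqType) : is_metric (@discrete_dist T).
Proof.
split=> [x y|x y|x y|x y z]; rewrite /discrete_dist.
- exact: ler0n.
- split=> [/eqP|->]; last by rewrite eqxx.
  by rewrite pnatr_eq0 eqb0 negbK => /eqP.
- by rewrite eq_sym.
- rewrite -natrD ler_nat; case: (eqVneq x y) => [->//|_].
  by case: (y != z); case: (x != z).
Qed.

Lemma metric_open_discrete (T : eqType) (A : set T) :
  metric_open (@discrete_dist T) A.
Proof. by move=> x Ax; exists 1; split=> // y /discrete_dist_lt1 <-. Qed.

Lemma discrete_dist_complete (T : eqType) : metric_complete (@discrete_dist T).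
Proof.
move=> u /(_ 1 ltr01)[N uN]; exists (u N) => e e0; exists N => n Nn.
by rewrite (discrete_dist_lt1 (uN n N Nn (leqnn N))) /discrete_dist eqxx.
Qed.

Lemma discrete_dist_separable (T : eqType) :
  countable [set: T] -> metric_separable (@discrete_dist T).
Proof.
by move=> cT; exists setT; split=> // x r r0; exists x => //;
  rewrite /discrete_dist eqxx.
Qed.

End discrete_metric.

Lemma finite_metric_compact (R : realType) (T : Type) (d : T -> T -> R) :
  finite_set [set: T] -> metric_compact d.
Proof.
move=> fT C _ /seteqP[_ covC].
have /choice[A AC] : forall x, exists A, C A /\ A x.
  by move=> x; have [A CA Ax] := covC x I; exists A.
exists (range A); split; first exact: finite_image.
  by move=> _ [x _ <-]; case: (AC x).
by apply/seteqP; split=> // x _; exists (A x); [exists x|case: (AC x)].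
Qed.

(** * Upper bound on the distance from an exact coupling *)

Section coupling_bound.
Context (R : realType) (X Y : pmm R).

Definition pmm_distortion (p : R)
    (z : (pmm_space X * pmm_space Y) * (pmm_space X * pmm_space Y)) : \bar R :=
  ((`| pmm_d z.1.1 z.2.1 - pmm_d z.1.2 z.2.2 | `^ p)%R)%:E.

Local Open Scope ereal_scope.

Lemma PGWk_le_coupling (k p : R)
    (g : probability (pmm_space X * pmm_space Y)%type R)
    (E : set (pmm_space X * pmm_space Y)) :
  (0 <= k)%R -> p != 0%R ->
  (forall A, measurable A -> g (A `*` setT) = pmm_mu X A) ->
  (forall B, measurable B -> g (setT `*` B) = pmm_mu Y B) ->
  measurable_fun setT (pmm_distortion p) ->
  measurable E -> 0 < g E ->
  (forall z w, E z -> E w -> pmm_d z.1 w.1 = pmm_d z.2 w.2) ->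
  PGWk k p X Y <= 1 - g E.
Proof.
move=> k0 p0 gX gY mdis mE gE0 dE.
have gEfin : g E \is a fin_num by exact: fin_num_measure.
have gE1 : g E <= 1 by exact: probability_le1.
set r := fine (g E); have gEr : g E = r%:E by rewrite fineK.
have r0 : (0 < r)%R by rewrite -lte_fin -gEr.
have r1 : (r <= 1)%R by rewrite -lee_fin -gEr.
(* The coupling conditioned on [E] has zero distortion, and conditioning costs
   exactly the factor [1 + eps = 1 / g E] on the marginals. *)
pose pi := mnormalize (mrestr g mE) g.
have piE A : pi A = g (A `&` E) * (r^-1)%:E.
  (* [mnormalize] falls back on [g] when the mass to divide by is 0 or infinite; here that mass is
     the positive real [r]. *)
  rewrite /pi /mnormalize /= /mrestr setTI -/r gEr ifF//.
  by apply/negbTE; rewrite negb_or gt_eqF.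
have pi_le A : measurable A -> pi A <= (1 + (r^-1 - 1))%:E * g A.
  move=> mA; rewrite piE addrC subrK muleC lee_wpmul2l//.
    by rewrite lee_fin invr_ge0 ltW.
  by apply: le_measure; rewrite ?inE//; exact: measurableI.
(* For [eps = 1 / r - 1] the value [eps / (1 + eps)] is exactly [1 - r]. *)
apply: ereal_inf_lbound; exists (r^-1 - 1)%R; last first.
  by rewrite gEr -EFinB; congr EFin;
    rewrite [(1 + (_ - _))%R]addrC subrK invrK mulrBl mulVf ?gt_eqF// mul1r.
have eps0 : (0 <= r^-1 - 1)%R by rewrite subr_ge0 invf_ge1.
split=> //; apply: (@le_trans _ _ 0); last by rewrite lee_fin mulr_ge0.
apply: ereal_inf_lbound; exists pi; split.
  split=> [A mA|B mB].
    by rewrite -gX//; apply: pi_le; exact: measurableX.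
  by rewrite -gY//; apply: pi_le; exact: measurableX.
rewrite /dis_Lp (@integral_prod_eq0 _ _ _ pi E)//.
(* Zero raised to the power 0 would be 1, so [p != 0] matters here. *)
- by rewrite poweR0r// invr_eq0.
- by rewrite [LHS]piE setIid gEr -EFinM divff// gt_eqF.
- by move=> z w Ez Ew /=; rewrite (dE _ _ Ez Ew) subrr normr0 powR0.
Qed.

End coupling_bound.

(** * Lower bounds on the distortion, and the tools for the pigeonhole argument *)

Section distortion_lower_bound.
Context (R : realType) (X Y : pmm R).
Local Open Scope ereal_scope.

(** The integrand is at least c^p on the product of the rectangles A x B and A' x B, and this
    product has mass at least s^2. *)
Lemma dis_Lp_ge_rect (p c s : R) (A A' : set (pmm_space X))
    (B : set (pmm_space Y))
    (pi : probability (pmm_space X * pmm_space Y)%type R) :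
  (0 < p)%R -> (0 <= c)%R -> (0 <= s)%R ->
  measurable A -> measurable A' -> measurable B ->
  (forall x x' y y', A x -> A' x' -> B y -> B y' ->
     c <= `|pmm_d x x' - pmm_d y y'|)%R ->
  s%:E <= pi (A `*` B) -> s%:E <= pi (A' `*` B) ->
  ((c `^ p * (s * s)) `^ p^-1)%:E <= dis_Lp p pi.
Proof.
move=> p0 c0 s0 mA mA' mB gap sA sA'.
rewrite -poweR_EFin /dis_Lp; apply: gt0_ler_poweR.
- by rewrite invr_ge0 ltW.
- by rewrite in_itv/= lee_fin leey !mulr_ge0// powR_ge0.
- rewrite in_itv/= leey andbT; apply: integral_ge0 => z _.
  by rewrite lee_fin powR_ge0.
have mAB := measurableX mA mB; have mAB' := measurableX mA' mB.
have rect : (pi \x pi) ((A `*` B) `*` (A' `*` B))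
    = pi (A `*` B) * pi (A' `*` B).
  exact: product_measure1E.
apply: (@le_trans _ _ ((c `^ p)%:E * (pi \x pi) ((A `*` B) `*` (A' `*` B)))).
  by rewrite rect EFinM lee_wpmul2l// ?lee_fin ?powR_ge0// EFinM lee_pmul.
apply: integral_ge_cst_on => //.
- exact: measurableX.
- exact: powR_ge0.
- move=> [[x y] [x' y']] /= [[Ax By] [Ax' By']].
  by rewrite lee_fin ge0_ler_powR// ?nnegrE ?(ltW p0)//; exact: gap.
Qed.

End distortion_lower_bound.

(** By subadditivity, if all [N] pieces of [A] had mass below [s], the mass of [A] would be at most
    [s *+ N]. *)
Lemma measure_cover_ge (d : measure_display) (T : measurableType d)
    (R : realType) (mu : {measure set T -> \bar R}) (A : set T) (N : nat)
    (B : nat -> set T) (s : R) :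
  measurable A -> (forall j, (j < N)%N -> measurable (B j)) ->
  (forall x, A x -> exists2 j, (j < N)%N & B j x) ->
  ((s *+ N)%:E < mu A)%E ->
  exists j : 'I_N, (s%:E <= mu (A `&` B j))%E.
Proof.
move=> mA mB cov sA; apply: contrapT => no.
have les j : (j < N)%N -> (mu (A `&` B j) <= s%:E)%E.
  move=> jN; rewrite leNgt; apply/negP => /ltW ?.
  by apply: no; exists (Ordinal jN).
have : (mu A <= \sum_(j < N) mu (A `&` B j))%E.
  have := @content_subadditive _ _ _ mu A (fun j => A `&` B j); apply => //.
    by move=> j jN; apply: measurableI => //; exact: mB.
  move=> x Ax; have [j jN Bx] := cov x Ax.
  by rewrite -(bigcup_mkord N (fun j => A `&` B j)); exists j.
apply/negP; rewrite -ltNge (le_lt_trans _ sA)//.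
rewrite -[in leRHS](card_ord N) -sumr_const -sumEFin.
by apply: lee_sum => j _; exact: les.
Qed.

Section metric_cover.
Context (R : realType) (T : Type) (d : T -> T -> R).

Lemma metric_open_ball (x : T) (r : R) :
  is_metric d -> metric_open d [set y | d x y < r].
Proof.
move=> [_ _ _ tri] y /= xyr; exists (r - d x y).
split; first by rewrite subr_gt0.
by move=> z /=; rewrite ltrBrDl; apply: le_lt_trans.
Qed.

(** Extract a finite subcover from the balls of radius r/2; two points of one such ball are less
    than [r] apart, through its center. *)
Lemma metric_compact_cover (r : R) : is_metric d -> metric_compact d -> 0 < r ->
  exists (N : nat) (B : nat -> set T),
    [/\ forall j, (j < N)%N -> metric_open d (B j),
        forall x, exists2 j, (j < N)%N & B j x &
        forall j y y', (j < N)%N -> B j y -> B j y' -> d y y' < r].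
Proof.
move=> dm cpt r0; have [d0 d1 dC tri] := dm.
have [] := cpt (range (fun x => [set y | d x y < r / 2])).
- by move=> _ [x _ <-]; exact: metric_open_ball.
- apply/seteqP; split=> // x _.
  exists [set y | d x y < r / 2]; first by exists x.
  by rewrite /= (d1 x x).2// divr_gt0.
move=> D [fD DC /seteqP[_ covD]].
have [s sD] := (finite_seqP D).1 fD.
have inD j : (j < size s)%N -> D (nth set0 s j).
  by move=> js; rewrite sD /=; exact: mem_nth.
exists (size s), (nth set0 s); split.
- by move=> j /inD/DC[x _ <-]; exact: metric_open_ball.
- move=> x; have [A] := covD x I; rewrite sD /= => As Ax.
  by exists (index A s); rewrite ?index_mem// nth_index.
- move=> j y y' /inD/DC[x _ <-] /= xy xy'.
  rewrite (le_lt_trans (tri y x y'))// (dC y x) [ltRHS]splitr.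
  exact: ltrD.
Qed.

End metric_cover.

(** Partial couplings bound marginals only from above, so the bound is applied to the complement of
    [A]: with m the mass of [A], the strip over [A] has mass at least 1 - (1 + eps)(1 - m) = (1 +
    eps) m - eps. *)
Lemma pcoupling_marginal_ge (R : realType) (X Y : pmm R) (eps w : R)
    (pi : probability (pmm_space X * pmm_space Y)%type R)
    (A : set (pmm_space X)) :
  0 <= eps -> 0 <= w -> pcoupling eps pi -> measurable A ->
  (w%:E <= pmm_mu X A -> (w - eps)%:E <= pi (A `*` setT))%E.
Proof.
move=> eps0 w0 [piX _] mA wA.
have mAC := measurableC mA.
have mAT : measurable (A `*` [set: pmm_space Y]) by exact: measurableX.
have CE : ~` (A `*` [set: pmm_space Y]) = ~` A `*` setT.
  apply/seteqP; split=> -[x y] /=; first by move=> nA; split=> // Ax; exact: nA.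
  by move=> [nA _] [].
have := piX _ mAC; rewrite -CE !probability_setC//.
have fpi : pi (A `*` setT) \is a fin_num by exact: fin_num_measure.
have fmu : pmm_mu X A \is a fin_num by exact: fin_num_measure.
move: wA; rewrite -(fineK fpi) -(fineK fmu) -!EFinB -EFinM !lee_fin.
by move: (fine _) (fine _) => a b; nra.
Qed.

(** * Separated atoms against a cover by small sets *)

Section separated_atoms.
Context (R : realType) (X Y : pmm R) (N : nat) (x : nat -> pmm_space X) (w : R).
Hypothesis mx : forall i, (i <= N)%N -> measurable [set x i].
Hypothesis xw : forall i, (i <= N)%N -> (w%:E <= pmm_mu X [set x i])%E.
Hypothesis x_sep : forall i j, (i <= N)%N -> (j <= N)%N -> i != j ->
  1 <= pmm_d (x i) (x j).
Context (B : nat -> set (pmm_space Y)).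
Hypothesis mB : forall j, (j < N)%N -> measurable (B j).
Hypothesis covB : forall y, exists2 j, (j < N)%N & B j y.
Hypothesis smallB : forall j y y', (j < N)%N -> B j y -> B j y' ->
  pmm_d y y' < 1 / 2.

Lemma dis_Lp_ge_atoms (p eps : R)
    (pi : probability (pmm_space X * pmm_space Y)%type R) :
  0 < p -> 0 < w -> 0 <= eps -> eps <= w / 2 -> pcoupling eps pi ->
  ((((1 / 2) `^ p * ((w / (2 * N.+1%:R)) * (w / (2 * N.+1%:R)))) `^ p^-1)%:E
     <= dis_Lp p pi)%E.
Proof.
(* This [s] satisfies [s *+ N < w / 2], while [eps <= w / 2] leaves the strip over each atom a mass
   of at least [w / 2]; hence some set of the cover receives at least [s] from it. *)
move=> p0 w0 eps0 epsw cpi; set s := w / _.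
have N0 : 0 < N.+1%:R :> R by rewrite ltr0n.
have s0 : 0 < s by rewrite divr_gt0// mulr_gt0.
have sN : s *+ N < w / 2.
  have : s *+ N.+1 = w / 2 by rewrite -mulr_natr /s; field; rewrite gt_eqF.
  by rewrite mulrS => <-; rewrite ltrDr.
have atom (i : 'I_N.+1) :
    exists j : 'I_N, (s%:E <= pi ([set x i] `*` B j))%E.
  have iN : (i <= N)%N by rewrite -ltnS.
  have [|j jN|[x1 y] _||j sj] := @measure_cover_ge _ _ _ pi
      ([set x i] `*` setT) N (fun j => setT `*` B j) s.
  - by apply: measurableX => //; exact: mx.
  - by apply: measurableX => //; exact: mB.
  - by have [j jN By] := covB y; exists j.
  - apply: (@lt_le_trans _ _ (w - eps)%:E); last first.
      by apply: pcoupling_marginal_ge => //; [exact: ltW|exact: mx|exact: xw].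
    by rewrite lte_fin (lt_le_trans sN)//; lra.
  - by exists j; rewrite -setXI setIT setTI in sj.
have [f fP] := choice atom.
(* There are [N.+1] atoms for [N] sets, so two atoms share one; the gap is then at least 1 - 1/2. *)
have : ~ injective f by move=> /leq_card; rewrite !card_ord ltnn.
move=> /existsNP[i /existsNP[j /not_implyP[fij /eqP ij]]].
have iN : (i <= N)%N by rewrite -ltnS.
have jN : (j <= N)%N by rewrite -ltnS.
apply: (@dis_Lp_ge_rect _ _ _ p (1 / 2) s [set x i] [set x j] (B (f i))) => //.
- exact: ltW.
- exact: mx.
- exact: mx.
- exact: mB.
- move=> _ _ y y' -> -> By By'.
  have := smallB (ltn_ord (f i)) By By'; have := x_sep iN jN ij => h1 h2.
  by rewrite (le_trans _ (ler_norm _))//; lra.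
- by rewrite fij.
Qed.

(** The bounds on [e] act in turn: [e <= 1 / 2] turns [eps / (1 + eps) < e] into [eps <= 2 * e],
    then [e <= w / 4] gives [eps <= w / 2], and the last one dominates [k * eps + e]. *)
Lemma PGWk_ge_atoms (k p e : R) : 0 < p -> 0 < k -> 0 < w ->
  0 < e -> e <= 1 / 2 -> e <= w / 4 ->
  (2 * k + 1) * e <=
    ((1 / 2) `^ p * ((w / (2 * N.+1%:R)) * (w / (2 * N.+1%:R)))) `^ p^-1 ->
  (e%:E <= PGWk k p X Y)%E.
Proof.
move=> p0 k0 w0 e0 e2 ew ec; rewrite leNgt; apply/negP.
move=> /ereal_inf_lt[_ [eps [eps0 PGWeps] <-]]; rewrite lte_fin.
rewrite ltr_pdivrMr; last by rewrite ltr_wpDr.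
move=> epse; have eps2e : eps <= 2 * e by nra.
(* The infimum need not be attained; the slack [e] makes the inequality strict and so yields an
   actual coupling. *)
have : (PGW_eps eps p X Y < (k * eps + e)%:E)%E.
  by rewrite (le_lt_trans PGWeps)// lte_fin ltrDl.
move=> /ereal_inf_lt[_ [pi [cpi ->]]]; apply/negP; rewrite -leNgt.
apply: (le_trans _ (dis_Lp_ge_atoms p0 w0 eps0 _ cpi)); last by lra.
by rewrite lee_fin (le_trans _ ec)//; nra.
Qed.

End separated_atoms.

(* ['I_n.+1] has no pointed structure in the library, hence this copy. *)
Definition pointed_ord (n : nat) : Type := 'I_n.+1.
HB.instance Definition _ n := Finite.on (pointed_ord n).
HB.instance Definition _ n := isPointed.Build (pointed_ord n) ord0.

Lemma measurable_set1_prod d1 d2 (T1 : measurableType d1)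
    (T2 : measurableType d2) :
  (forall x : T1, measurable [set x]) -> (forall y : T2, measurable [set y]) ->
  forall z : T1 * T2, measurable [set z].
Proof.
move=> m1 m2 [x y]; rewrite (_ : [set (x, y)] = [set x] `*` [set y]).
  exact: measurableX.
by apply/seteqP; split=> -[u v] /=; [case=> -> ->|case=> -> ->].
Qed.

(** * The Cauchy sequence of truncated Poisson spaces *)

Section truncated_poisson.
Context (R : realType).

(* The second argument of [poisson_prob] is a dummy. *)
Let P : probability nat R := poisson_prob 1 0.

Let disc_space n :=
  g_sigma_algebraType (metric_open (@discrete_dist R (pointed_ord n))).

Lemma measurable_disc n (A : set (disc_space n)) : measurable A.
Proof. by apply: sub_sigma_algebra; exact: metric_open_discrete. Qed.

Definition truncate n (i : nat) : disc_space n := inord (minn i n).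

Lemma measurable_truncate n : measurable_fun setT (truncate n).
Proof. by []. Qed.

HB.instance Definition _ n :=
  isMeasurableFun.Build _ _ _ _ (truncate n) (@measurable_truncate n).

Lemma pointed_ord_finite n : finite_set [set: pointed_ord n].
Proof. exact: finite_finset. Qed.

Definition poisson_space n : pmm R :=
  @PMM R (pointed_ord n) (@discrete_dist R (pointed_ord n))
    (discrete_dist_is_metric R (pointed_ord n))
    (discrete_dist_complete (T := pointed_ord n))
    (discrete_dist_separable R (finite_set_countable (pointed_ord_finite n)))
    (distribution P (truncate n)).

Lemma poisson_space_compact n : pmm_compact (poisson_space n).
Proof. exact: finite_metric_compact (pointed_ord_finite n). Qed.

Definition poisson_weight (N : nat) : R := N`!%:R^-1 * expR (- 1).

Lemma poisson_weight_gt0 N : 0 < poisson_weight N.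
Proof. by rewrite mulr_gt0 ?expR_gt0// invr_gt0 ltr0n fact_gt0. Qed.

Lemma poisson_atom (i : nat) : P [set i] = (poisson_weight i)%:E.
Proof.
rewrite /P /= /poisson_prob ltr01 esum_set1 /poisson_pmf ltr01 ?expr1n//.
by rewrite mul1r.
Qed.

(** Truncation can only add mass to the atom [i], and the Poisson weights of rate 1 are
    nonincreasing. The bound does not depend on [n]. *)
Lemma poisson_space_atom n N i : (i <= N)%N -> (N <= n)%N ->
  ((poisson_weight N)%:E <= pmm_mu (poisson_space n) [set truncate n i])%E.
Proof.
move=> iN Nn; apply: (@le_trans _ _ (P [set i])).
  rewrite poisson_atom lee_fin ler_pM2r ?expR_gt0// lef_pV2 ?posrE ?ltr0n
    ?fact_gt0//.
  by rewrite ler_nat leq_fact.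
by apply: le_measure; rewrite ?inE// => _ ->.
Qed.

Lemma truncate_inj n i j : (i <= n)%N -> (j <= n)%N -> i != j ->
  @discrete_dist R (pointed_ord n) (truncate n i) (truncate n j) = 1.
Proof.
move=> iN jN ij; rewrite /discrete_dist; case: eqP => // /(congr1 val) /=.
rewrite !inordK ?ltnS ?geq_minr// (minn_idPl iN) (minn_idPl jN) => /eqP.
by rewrite (negbTE ij).
Qed.

(** Continuity from below: the initial segments increase to [nat], which has mass 1. *)
Lemma poisson_initial (e : R) : 0 < e ->
  exists K, (1 - P `I_K < e%:E)%E.
Proof.
move=> e0; apply: contrapT => /forallNP no.
have PI K : (P `I_K <= (1 - e)%:E)%E.
  have fP : P `I_K \is a fin_num by exact: fin_num_measure.
  have /negP := no K; rewrite -leNgt -(fineK fP) -EFinB !lee_fin.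
  by rewrite lerBrDr -lerBrDl.
have cvgP : P \o (fun K => `I_K) @ \oo --> P (\bigcup_K `I_K).
  apply: nondecreasing_cvg_mu => //.
  by move=> m n mn; apply/subsetPset => i /= im; exact: leq_trans mn.
have UT : \bigcup_K `I_K = [set: nat].
  by apply/seteqP; split=> // i _; exists i.+1 => //=.
have : (P (\bigcup_K `I_K) <= (1 - e)%:E)%E.
  rewrite -(cvg_lim _ cvgP)//; apply: lime_le.
    by apply/cvg_ex; exists (P (\bigcup_K `I_K)).
  by near=> K; exact: PI.
rewrite UT probability_setT lee_fin lerBrDl gerDr leNgt => /negP; exact.
Unshelve. all: by end_near.
Qed.

Definition truncate_pair m n (i : nat) : disc_space m * disc_space n :=
  (truncate m i, truncate n i).

Lemma measurable_truncate_pair m n : measurable_fun setT (truncate_pair m n).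
Proof. by []. Qed.

HB.instance Definition _ m n :=
  isMeasurableFun.Build _ _ _ _ (truncate_pair m n)
    (@measurable_truncate_pair m n).

Lemma PGWk_poisson_space (k p : R) (K m n : nat) : 0 <= k -> p != 0 ->
  (0 < K)%N -> (K <= m)%N -> (K <= n)%N ->
  (PGWk k p (poisson_space m) (poisson_space n) <= 1 - P `I_K)%E.
Proof.
move=> k0 p0 K0 Km Kn.
have m1 l (x : disc_space l) : measurable [set x] by exact: measurable_disc.
pose g : probability _ R := distribution P (truncate_pair m n).
(* On [E] both coordinates are the same index, so the two discrete distances agree. It contains the
   image of every [i < K], since neither truncation moves such an [i]. *)
pose E : set (disc_space m * disc_space n) :=
  [set z | (z.1 : 'I_m.+1) = (z.2 : 'I_n.+1) :> nat /\ ((z.1 : 'I_m.+1) < K)%N].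
have m2 (z : disc_space m * disc_space n) : measurable [set z].
  exact: measurable_set1_prod.
have mE : measurable E.
  apply: countable_measurable => //.
  exact: (countableP (T := ('I_m.+1 * 'I_n.+1)%type)).
have PE : (P `I_K <= g E)%E.
  apply: le_measure; rewrite ?inE// => i /= iK; rewrite /E /=.
  have le_im := leq_trans (ltnW iK) Km; have le_in := leq_trans (ltnW iK) Kn.
  by rewrite !inordK ?ltnS ?geq_minr// (minn_idPl le_im) (minn_idPl le_in).
(* [0 < K] puts the index 0 in the initial segment, so the conditioning event is not null. *)
have PK0 : (0 < P `I_K)%E.
  apply: (@lt_le_trans _ _ (P [set 0])).
    by rewrite poisson_atom lte_fin poisson_weight_gt0.
  by apply: le_measure; rewrite ?inE// => _ ->.
apply: (@le_trans _ _ (1 - g E)%E); last exact: leeB.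
apply: PGWk_le_coupling => //.
- move=> A mA; rewrite /= /g /distribution /pushforward; congr (P _).
  by apply/seteqP; split=> i /=; [case|].
- move=> A mA; rewrite /= /g /distribution /pushforward; congr (P _).
  by apply/seteqP; split=> i /=; [case|].
- move=> _ C mC; rewrite setTI; apply: countable_measurable.
    by move=> z; exact: measurable_set1_prod.
  exact: (countableP
    (T := ((('I_m.+1 * 'I_n.+1) * ('I_m.+1 * 'I_n.+1))%type))).
- exact: lt_le_trans PE.
- move=> [x y] [x' y'] [/= xy _] [/= xy' _]; rewrite /= /discrete_dist.
  by rewrite -!val_eqE /= xy xy'.
Qed.

End truncated_poisson.

(** * Failure of completeness *)

Theorem theorem4p6 (R : realType) (p k : R) : 1 <= p -> 0 < k ->
  exists X : nat -> pmm R,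
    (forall n, pmm_compact (X n)) /\
    (forall e : R, 0 < e -> exists N : nat, forall m n : nat,
       (N <= m)%N -> (N <= n)%N -> (PGWk k p (X m) (X n) < e%:E)%E) /\
    ~ (exists Y : pmm R, pmm_compact Y /\
         forall e : R, 0 < e -> exists N : nat, forall n : nat,
           (N <= n)%N -> (PGWk k p (X n) Y < e%:E)%E).
Proof.
move=> p1 k0; have p0 : 0 < p by rewrite (lt_le_trans ltr01).
exists (@poisson_space R); split; first exact: poisson_space_compact.
split=> [e e0|[Y [cptY limY]]].
  (* [K] may be 0; its successor gives a nonempty initial segment of no smaller mass. *)
  have [K Ke] := poisson_initial e0; exists K.+1 => m n Km Kn.
  apply: (le_lt_trans (PGWk_poisson_space _ _ _ Km Kn)) => //.
  - exact: ltW.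
  - by rewrite gt_eqF.
  - apply: le_lt_trans Ke; apply: leeB => //; apply: le_measure; rewrite ?inE//.
    by move=> i /= iK; exact: ltnW.
have [N [B [oB covB smallB]]] :=
  metric_compact_cover (pmm_is_metric Y) cptY
    (@divr_gt0 _ 1 2 ltr01 (ltr0Sn _ _)).
set w := poisson_weight R N; have w0 : 0 < w by exact: poisson_weight_gt0.
set c := ((1 / 2) `^ p * ((w / (2 * N.+1%:R)) * (w / (2 * N.+1%:R)))) `^ p^-1.
have c0 : 0 < c.
  by rewrite powR_gt0// mulr_gt0 ?powR_gt0// mulr_gt0// divr_gt0.
(* The three thresholds of [PGWk_ge_atoms]; they depend on [Y] through [N], but not on the index in
   the sequence. *)
pose e := Num.min (1 / 2) (Num.min (w / 4) (c / (2 * k + 1))).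
have k1 : 0 < 2 * k + 1 by rewrite addr_gt0// mulr_gt0.
have e0 : 0 < e by rewrite /e !lt_min !divr_gt0.
have [M limM] := limY _ e0.
(* An index beyond [M] for the limit, and at least [N] so that the atoms 0, ..., N are distinct. *)
have := limM (maxn N M) (leq_maxr _ _); apply/negP; rewrite -leNgt.
have NM := leq_maxl N M.
apply: (@PGWk_ge_atoms R (poisson_space R (maxn N M)) Y N
  (truncate R (maxn N M)) w _ _ _ B) => //.
- by move=> i _; exact: measurable_disc.
- by move=> i iN; exact: poisson_space_atom.
- move=> i j iN jN ij; rewrite /= truncate_inj// ?(leq_trans iN)//.
  exact: leq_trans jN NM.
- by move=> j jN; apply: sub_sigma_algebra; exact: oB.
- by rewrite /e ge_min lexx.
- by rewrite /e !ge_min lexx orbT.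
- by rewrite mulrC -ler_pdivlMr// /e !ge_min lexx !orbT.
Qed.
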